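(* Let $f:X\to\mathbb{R}$ be a tame function and let $\mathrm{CV}(f)$ be the set of values where the homotopy type of $f^{-1}(-\infty,u]$ changes (the critical values of $f$). Then $$\int_X f\,\lceil d\chi\rceil=\sum_{v\in\mathrm{CV}(f)}\Delta_\chi(f,v)\,v,$$ where $\Delta_\chi(f,v)=\chi(f\le v+\varepsilon)-\chi(f\le v-\varepsilon)$, for sufficiently small $\varepsilon>0$, is the change in the Euler characteristic of $f^{-1}(-\infty,u]$ as $u$ passes through the critical value $v$.
   Context: $\chi$ is the Euler characteristic (with $\chi(\emptyset)=0$). A continuous function $f:X\to\mathbb{R}$ on a compact topological space $X$ with finite Euler characteristic is tame if the homotopy types of $f^{-1}(-\infty,u]$ and $f^{-1}[u,\infty)$ change only finitely many times as $u$ varies over $\mathbb{R}$ and the Euler characteristic of each of these sets is finite. Write $\chi(f\le u)=\chi(f^{-1}(-\infty,u])$ and define $\chi(f>u):=\chi(X)-\chi(f\le u)$. For tame $f$, the upper Euler integral is $\int_X f\,\lceil d\chi\rceil=\int_0^\infty[\chi(f>u)-\chi(f\le -u)]\,du$. *)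

(* Defs.v *)
From HB Require Import structures.
(* freeg comes first because its lift would hide that of fintype. *)
From mathcomp Require Import freeg.
From mathcomp Require Import all_boot all_order all_algebra.
From mathcomp Require Import all_classical all_reals all_analysis.

Set Implicit Arguments.
Unset Strict Implicit.
Unset Printing Implicit Defensive.

Import Order.TTheory GRing.Theory Num.Theory.
Import numFieldNormedType.Exports.

Local Open Scope classical_set_scope.
Local Open Scope ring_scope.

(* Singular homology with rational coefficients.  A subset A of a space, used
   as a type, is a set_type with the subspace topology. *)

Definition std_simplex (R : realType) (n : nat) : set 'rV[R]_n.+1 :=
  [set x | (forall i, 0 <= x ord0 i) /\ \sum_i x ord0 i = 1].
Arguments std_simplex : clear implicits.

Definition insert0 (R : realType) (n : nat) (i : 'I_n.+2) (x : 'rV[R]_n.+1) :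
    'rV[R]_n.+2 :=
  \row_j (if unlift i j is Some k then x ord0 k else 0).

Lemma insert0_simplex (R : realType) (n : nat) (i : 'I_n.+2)
    (x : std_simplex R n) :
  insert0 i (val x) \in std_simplex R n.+1.
Proof.
case: x => x /= /set_mem[x_ge0 x_sum1]; apply/mem_set; split=> [j|].
  by rewrite mxE; case: unliftP.
rewrite (bigD1_ord i) //= mxE unlift_none add0r -[RHS]x_sum1.
by apply: eq_bigr => k _; rewrite mxE liftK.
Qed.

Definition face_map (R : realType) (n : nat) (i : 'I_n.+2)
    (x : std_simplex R n) : std_simplex R n.+1 :=
  SigSub (insert0_simplex i x).

Lemma face_map_continuous (R : realType) (n : nat) (i : 'I_n.+2) :
  continuous (@face_map R n i).
Proof.
apply: continuous_comp_initial => x U /= [P Pnbhs PU].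
rewrite nbhs_simpl /=.
pose Q (k : 'I_1) (j : 'I_n.+1) := P ord0 (lift i j).
have : nbhs x (val @^-1` [set y : 'rV[R]_n.+1 | forall k j, Q k j (y k j)]).
  apply: (@initial_continuous _ _ _ x); exists Q => // k j.
  have := Pnbhs ord0 (lift i j).
  by rewrite /= mxE liftK (ord1 k).
apply: filterS => y Qy; apply: PU => k j; rewrite (ord1 k) /= mxE.
case: unliftP => [l ->|jE]; first exact: (Qy ord0 l).
have := nbhs_singleton (Pnbhs ord0 j).
by rewrite /= mxE jE unlift_none.
Qed.

HB.instance Definition _ (R : realType) (n : nat) (i : 'I_n.+2) :=
  isContinuous.Build _ _ (@face_map R n i) (@face_map_continuous R n i).

Definition sing_simplex (R : realType) (X : topologicalType) (n : nat) :=
  continuousType (std_simplex R n) X.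

Definition sing_face (R : realType) (X : topologicalType) (n : nat)
    (s : sing_simplex R X n.+1) (i : 'I_n.+2) : sing_simplex R X n :=
  s \o @face_map R n i.

Definition chain (R : realType) (X : topologicalType) (n : nat) :=
  {freeg (sing_simplex R X n) / rat}.

Definition bd (R : realType) (X : topologicalType) (n : nat) :
    chain R X n.+1 -> chain R X n :=
  fglift (fun s => \sum_(i < n.+2) (-1) ^+ i *: [freeg [:: (1, sing_face s i)]]).

Definition is_cycle (R : realType) (X : topologicalType) (n : nat) :
    chain R X n -> Prop :=
  if n is m.+1 then fun c => bd c = 0 else fun=> True.

Definition is_boundary (R : realType) (X : topologicalType) (n : nat)
    (c : chain R X n) : Prop :=
  exists b : chain R X n.+1, bd b = c.

(* dim H_n(X; Q) = k: some k cycles represent a basis of cycles modulo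
   boundaries. *)
Definition has_betti (R : realType) (X : topologicalType) (n k : nat) : Prop :=
  exists z : 'I_k -> chain R X n,
    (forall i, is_cycle (z i)) /\
    (forall c, is_cycle c ->
       exists! a : {ffun 'I_k -> rat}, is_boundary (c - \sum_i a i *: z i)).

(* The Betti numbers are all finite and almost all zero, with alternating sum
   x. *)
Definition has_euler (R : realType) (X : topologicalType) (x : int) : Prop :=
  exists (b : nat -> nat) (N : nat),
    [/\ forall n, has_betti R X n (b n),
        forall n, (N <= n)%N -> b n = 0%N &
        x = \sum_(n < N) (-1) ^+ n * (b n)%:Z].

Definition finite_euler (R : realType) (X : topologicalType) : Prop :=
  exists x, has_euler R X x.

Definition euler (R : realType) (X : topologicalType) : int :=
  xget 0 [set x | has_euler R X x].

Definition homotopic (R : realType) (X Y : topologicalType) (f g : X -> Y) :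
    Prop :=
  exists H : X * R -> Y,
    [/\ {within [set: X] `*` `[0, 1], continuous H},
        forall x, H (x, 0) = f x & forall x, H (x, 1) = g x].

Definition homotopy_equivalent (R : realType) (X Y : topologicalType) : Prop :=
  exists (f : X -> Y) (g : Y -> X),
    [/\ continuous f, continuous g,
        homotopic R (g \o f) idfun & homotopic R (f \o g) idfun].

(* The values at which the homotopy type of the family F is not locally
   constant. *)
Definition htype_changes (R : realType) (F : R -> topologicalType) : set R :=
  [set v | ~ \forall u \near v, homotopy_equivalent R (F u) (F v)].

Section tame.
Variables (R : realType) (X : topologicalType).
Implicit Type f : X -> R.

Definition sublevel f (u : R) : topologicalType := f @^-1` `]-oo, u].

Definition superlevel f (u : R) : topologicalType := f @^-1` `[u, +oo[.

Definition CV f : set R := htype_changes (sublevel f).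

Definition tame f : Prop :=
  [/\ compact [set: X], finite_euler R X, continuous f,
      finite_set (CV f) /\ finite_set (htype_changes (superlevel f)) &
      forall u, finite_euler R (sublevel f u) /\
                finite_euler R (superlevel f u)].

Definition chi_le f (u : R) : int := euler R (sublevel f u).

Definition chi_gt f (u : R) : int := euler R X - chi_le f u.

Definition upper_euler_integral f : \bar R :=
  (\int[lebesgue_measure]_(u in `[0%R, +oo[)
    ((chi_gt f u - chi_le f (- u))%:~R%R)%:E)%E.

(* The eventual value of the difference as e decreases to 0. *)
Definition Delta_chi f (v : R) : int :=
  xget 0 [set d | \forall e \near 0^'+, chi_le f (v + e) - chi_le f (v - e) = d].

End tame.

(* Main.v *)
(* The Euler characteristic is a homotopy invariant (singular chains, prism
   operator), so u |-> chi(f <= u) is locally constant off the finite set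
   CV(f); by compactness it is 0 for u small and chi(X) for u large.  Hence, off
   CV(f), chi(f <= u) is the sum of the jumps Delta(v) over the critical values
   v < u, and chi(X) is the sum of all of them.  The integrand is therefore, up
   to finitely many points, the sum over v of Delta(v) (1[u <= v] - 1[v < -u]),
   and the integral of 1[u <= v] - 1[v < -u] over u >= 0 is v. *)

From HB Require Import structures.
Require Import Defs.
From mathcomp Require Import freeg.
From mathcomp Require Import all_boot all_order all_algebra.
From mathcomp Require Import all_classical all_reals all_analysis.
From mathcomp Require Import ring lra.

Import Order.TTheory GRing.Theory Num.Theory.
Import numFieldNormedType.Exports.

Local Open Scope classical_set_scope.
Local Open Scope ring_scope.

Set Implicit Arguments.
Unset Strict Implicit.
Unset Printing Implicit Defensive.

(** * Prism operators on lists of vertices *)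

Section simplicial_prism.
Variables (K : pzRingType) (M : lmodType K).

Definition delete_nth (T : Type) (i : nat) (s : seq T) : seq T :=
  take i s ++ drop i.+1 s.

(** The boundary formula, with values in any module. Leaving [phi] free lets an induction on the
    list absorb the leading vertex into [phi]. *)
Definition alt_faces (T : Type) (phi : seq T -> M) (s : seq T) : M :=
  \sum_(i < size s) (-1) ^+ i *: phi (delete_nth i s).

(* On [:: v_0; ...; v_n] this is the alternating sum over i of the values of
   [phi] at (v_0,0), ..., (v_i,0), (v_i,1), ..., (v_n,1). *)
Fixpoint prism (T : Type) (phi : seq (T * bool) -> M) (s : seq T) : M :=
  if s is v :: r then
    phi ((v, false) :: (v, true) :: [seq (x, true) | x <- r])
      - prism (fun q => phi ((v, false) :: q)) r
  else 0.

(** Boundary of a cone with apex [v]: the face opposite [v] is the base, and the other faces keep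
    [v] and shift their sign by one. *)
Lemma alt_faces_cons (T : Type) (phi : seq T -> M) v s :
  alt_faces phi (v :: s) = phi s - alt_faces (fun r => phi (v :: r)) s.
Proof.
rewrite /alt_faces big_ord_recl /= expr0 scale1r /delete_nth /= drop0 -sumrN.
by congr (_ + _); apply: eq_bigr => i _; rewrite exprS mulN1r scaleNr.
Qed.

Lemma alt_facesB (T : Type) (phi psi : seq T -> M) s :
  alt_faces (fun r => phi r - psi r) s = alt_faces phi s - alt_faces psi s.
Proof.
by rewrite /alt_faces -sumrB; apply: eq_bigr => i _; rewrite scalerBr.
Qed.

Lemma alt_faces_map (T U : Type) (h : T -> U) (phi : seq U -> M) s :
  alt_faces phi (map h s) = alt_faces (phi \o map h) s.
Proof.
rewrite /alt_faces size_map; apply: eq_bigr => i _.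
by rewrite /delete_nth /= map_cat map_take map_drop.
Qed.

Lemma prismB (T : Type) (phi psi : seq (T * bool) -> M) s :
  prism (fun r => phi r - psi r) s = prism phi s - prism psi s.
Proof.
elim: s phi psi => [|v s IHs] phi psi /=; first by rewrite subr0.
rewrite IHs opprD addrACA -opprD //.
Qed.

Lemma eq_prism (T : Type) (phi psi : seq (T * bool) -> M) s :
  (forall r, size r = (size s).+1 -> phi r = psi r) -> prism phi s = prism psi s.
Proof.
elim: s phi psi => //= v s IHs phi psi eq_phi.
by congr (_ - _); [apply: eq_phi; rewrite /= size_map|
  apply: IHs => r size_r; apply: eq_phi; rewrite /= size_r].
Qed.

Lemma prism_map (T U : Type) (h : T -> U) (phi : seq (U * bool) -> M) s :
  prism phi (map h s) =
  prism (fun r => phi [seq (h x.1, x.2) | x <- r]) s.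
Proof.
by elim: s phi => //= v s IHs phi; rewrite IHs -!map_comp.
Qed.

(** The prism identity: boundary of the prism is top minus bottom minus prism of the boundary. After
    both sides are expanded at the head [v], the inner wall spanned by [(v, false)] and the upper
    copy of [s] occurs twice with opposite signs. *)
Lemma prism_alt_faces (T : Type) (phi : seq (T * bool) -> M) s :
  prism (alt_faces phi) s =
    phi [seq (x, true) | x <- s] - phi [seq (x, false) | x <- s]
      - alt_faces (prism phi) s.
Proof.
elim: s phi => [|v s IHs] phi.
  by rewrite /= /alt_faces big_ord0 !subrr.
rewrite /= alt_faces_cons alt_faces_cons.
under eq_prism do rewrite alt_faces_cons.
rewrite prismB IHs alt_faces_cons (alt_faces_map (pair^~ true)).
rewrite [alt_faces (fun r => prism phi (v :: r)) s](alt_facesB _ (prism _)).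
by rewrite !opprB -!addrA addKr; congr (_ + _); exact: addrCA.
Qed.

End simplicial_prism.

Lemma prism_linear (K : pzRingType) (M N : lmodType K) (F : {linear M -> N})
    (T : Type) (phi : seq (T * bool) -> M) s :
  F (prism phi s) = prism (F \o phi) s.
Proof.
by elim: s phi => [|v s IHs] phi /=; rewrite ?linear0 // linearB /= IHs.
Qed.

(** * Linear maps out of a free module *)

Section free_module.
Variables (K : nzRingType) (S : choiceType) (M : lmodType K).

Lemma fglift_linear (phi : S -> M) : linear (fglift phi).
Proof.
move=> k c d.
have fgliftD := lift_is_additive phi.
pose add_mixin := GRing.isZmodMorphism.Build _ _ (fglift phi) fgliftD.
pose L : {additive {freeg S / K} -> M} := HB.pack (fglift phi) add_mixin.
have -> : fglift phi = L by [].
rewrite raddfD; congr (_ + _).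
rewrite -{2}[c]freeg_sumE [k *: c]/(fgscale k c) /fgscale !raddf_sum.
by apply: eq_bigr => x _; rewrite /= !liftU scalerA.
Qed.

HB.instance Definition _ (phi : S -> M) :=
  GRing.isLinear.Build K {freeg S / K} M _ (fglift phi) (fglift_linear phi).

(** This reduces the identities between operators on chains to a single simplex. *)
Lemma freeg_linear_ext (F G : {linear {freeg S / K} -> M}) :
  (forall x, F << x >> = G << x >>) -> F =1 G.
Proof.
move=> FG c; rewrite -[c]freeg_sumE !linear_sum; apply: eq_bigr => x _.
have -> : << coeff x c *g x >> = coeff x c *: << x >> :> {freeg S / K}.
  by apply/eqP/freeg_eqP => y; rewrite coeffZ !coeffU mul1r.
by rewrite !linearZ FG.
Qed.

End free_module.

(** * Affine simplices in a prism *)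

Lemma continuous_row (T U : topologicalType) (n : nat) (F : T -> 'rV[U]_n) :
  (forall j, continuous (fun t => F t ord0 j)) -> continuous F.
Proof.
move=> F_cont t W [P FtP PW]; rewrite /nbhs /=.
have : nbhs t (fun u => forall j, P ord0 j (F u ord0 j)).
  by apply: filter_forall => j; exact: F_cont (FtP ord0 j).
by apply: filterS => u Pu; apply: PW => i j; rewrite (ord1 i).
Qed.

(** A homotopy is continuous only within [X] times [[0, 1]]; this makes its composite with a map
    into that set continuous. *)
Lemma within_continuous_into (T U V : topologicalType) (A : set U)
    (H : U -> V) (F : T -> U) :
  {within A, continuous H} -> (forall t, A (F t)) -> continuous F ->
  continuous (H \o F).
Proof.
move=> /subspace_continuousP H_cont AF F_cont t.
apply: cvg_trans (H_cont _ (AF t)) => W /= HW.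
have := F_cont t _ HW; rewrite /nbhs /=.
by apply: filterS => u; apply.
Qed.

Section affine_simplex.
Variables (R : realType) (n : nat).
Implicit Type s : seq ('I_n.+1 * bool).

Local Notation vert := (nth (ord0, false)).

(* The pair (k, b) stands for the vertex (e_k, b) of the prism
   Delta^n x [0, 1], so that a list of m + 1 such pairs spans an affine
   m-simplex t |-> (bary s t, bary_height s t) in it. *)
Definition bary_point s m (t : 'rV[R]_m.+1) : 'rV[R]_n.+1 :=
  \row_k \sum_(j < m.+1) t ord0 j * ((vert s j).1 == k)%:R.

Definition bary_height s m (t : 'rV[R]_m.+1) : R :=
  \sum_(j < m.+1) t ord0 j * (vert s j).2%:R.

Lemma bary_point_simplex s m (t : std_simplex R m) :
  bary_point s (val t) \in std_simplex R n.
Proof.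
case: t => t /= /set_mem[t_ge0 t_sum1]; apply/mem_set; split=> [k|].
  by rewrite mxE; apply: sumr_ge0 => j _; rewrite mulr_ge0.
rewrite -t_sum1; under eq_bigr do rewrite mxE.
rewrite exchange_big; apply: eq_bigr => j _ /=.
rewrite (bigD1 (vert s j).1) //= eqxx mulr1 big1 ?addr0 // => k.
by rewrite eq_sym => /negPf->; rewrite mulr0.
Qed.

Definition bary s m (t : std_simplex R m) : std_simplex R n :=
  SigSub (bary_point_simplex s t).

Lemma bary_height_itv s m (t : std_simplex R m) :
  bary_height s (val t) \in `[0, 1].
Proof.
case: t => t /= /set_mem[t_ge0 t_sum1]; rewrite in_itv /= -t_sum1.
by apply/andP; split; [apply: sumr_ge0|apply: ler_sum] => j _;
  rewrite ?mulr_ge0 // ler_piMr // lern1 leq_b1.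
Qed.

Lemma simplex_linear_continuous m (w : 'I_m.+1 -> R) :
  continuous (fun t : std_simplex R m => \sum_(j < m.+1) val t ord0 j * w j).
Proof.
apply: continuous_big => [|j _]; first exact: add_continuous.
move=> t; apply: cvgMl; first exact: nbhs_filter.
exact: (cvg_comp _ _ (@initial_continuous (std_simplex R m) _ val t)
  (@coord_continuous R 1 m.+1 ord0 j (val t))).
Qed.

Lemma bary_continuous s m : continuous (@bary s m).
Proof.
apply: continuous_comp_initial; apply: continuous_row => k.
rewrite (_ : (fun _ => _) = fun t : std_simplex R m =>
  \sum_(j < m.+1) val t ord0 j * ((vert s j).1 == k)%:R); last first.
  by apply/funext => t /=; rewrite mxE.
exact: simplex_linear_continuous.
Qed.

Lemma bary_height_continuous s m :
  continuous (fun t : std_simplex R m => bary_height s (val t)).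
Proof. exact: simplex_linear_continuous. Qed.

(** The inserted zero coordinate kills the [i]-th summand. The weight [w] is free so as to serve
    both the point and the height. *)
Lemma sum_insert0 m (i : 'I_m.+2) (t : 'rV[R]_m.+1) s
    (w : 'I_n.+1 * bool -> R) : (i < size s)%N ->
  \sum_(j < m.+2) insert0 i t ord0 j * w (vert s j) =
  \sum_(j < m.+1) t ord0 j * w (vert (delete_nth i s) j).
Proof.
move=> i_lt; rewrite (bigD1_ord i) //= mxE unlift_none mul0r add0r.
apply: eq_bigr => j _; rewrite mxE liftK; congr (_ * w _).
rewrite /delete_nth nth_cat size_take i_lt /= /bump.
case: ltnP => ij; first by rewrite nth_take // leqNgt ij.
by rewrite nth_drop addSn subnKC.
Qed.

Lemma bary_face m (i : 'I_m.+2) (t : std_simplex R m) s : (i < size s)%N ->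
  bary s (face_map i t) = bary (delete_nth i s) t.
Proof.
move=> i_lt; apply/val_inj/rowP => k; rewrite !mxE.
exact: (sum_insert0 _ (fun v => (v.1 == k)%:R)).
Qed.

Lemma bary_height_face m (i : 'I_m.+2) (t : std_simplex R m) s :
  (i < size s)%N ->
  bary_height s (val (face_map i t)) = bary_height (delete_nth i s) (val t).
Proof. exact: (sum_insert0 _ (fun v => v.2%:R)). Qed.

End affine_simplex.

Lemma bary_map_lift (R : realType) n m (i : 'I_n.+2)
    (s : seq ('I_n.+1 * bool)) (t : std_simplex R m) :
  size s = m.+1 ->
  bary [seq (lift i v.1, v.2) | v <- s] t = face_map i (bary s t).
Proof.
move=> size_s; apply/val_inj/rowP => k; rewrite !mxE.
(* The size of [s] keeps [j] in range; the default vertex [ord0] need not be fixed by [lift i]. *)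
have nthE (j : 'I_m.+1) :
    nth (ord0, false) [seq (lift i v.1, v.2) | v <- s] j =
    (lift i (nth (ord0, false) s j).1, (nth (ord0, false) s j).2).
  by rewrite (nth_map (ord0, false)) // size_s.
under eq_bigr do rewrite nthE /=.
case: unliftP => [l ->|->].
  by rewrite mxE; under eq_bigr do rewrite (inj_eq lift_inj).
by rewrite big1 // => j _; rewrite eq_sym (negPf (neq_lift _ _)) mulr0.
Qed.

Lemma bary_height_map_lift (R : realType) n m (i : 'I_n.+2)
    (s : seq ('I_n.+1 * bool)) (t : 'rV[R]_m.+1) :
  size s = m.+1 ->
  bary_height [seq (lift i v.1, v.2) | v <- s] t = bary_height s t.
Proof.
move=> size_s; apply: eq_bigr => j _.
by rewrite (nth_map (ord0, false)) // size_s.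
Qed.

(** * Homotopic maps on singular chains *)

(** A face of the standard vertex list is a relabelled standard list, so a prism over a face can be
    compared with the prism of [sing_face]. *)
Lemma delete_nth_enum n (i : 'I_n.+2) :
  delete_nth i (enum 'I_n.+2) = map (lift i) (enum 'I_n.+1).
Proof.
have size_del : size (delete_nth i (enum 'I_n.+2)) = n.+1.
  rewrite size_cat size_take size_drop size_enum_ord ltn_ord subSS.
  by rewrite subnKC // -ltnS.
apply: (@eq_from_nth _ ord0) => [|j]; rewrite size_del.
  by rewrite size_map size_enum_ord.
move=> j_lt; apply/val_inj => /=.
rewrite (nth_map ord0) ?size_enum_ord //= /delete_nth nth_cat size_take.
rewrite size_enum_ord ltn_ord nth_enum_ord // /bump.
case: ltnP => ij /=.
  by rewrite nth_take // nth_enum_ord // (ltn_trans ij).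
by rewrite nth_drop addSn subnKC // nth_enum_ord.
Qed.

Section singular_chains.
Variable R : realType.
Implicit Types X Y Z : topologicalType.

HB.instance Definition _ X n :=
  GRing.Linear.copy (@bd R X n) (fglift _).

Lemma bd_simplex X n (s : sing_simplex R X n.+1) :
  bd << s >> = \sum_(i < n.+2) (-1) ^+ i *: << sing_face s i >>.
Proof. by rewrite /bd liftU scale1r. Qed.

Definition chain_map X Y (f : continuousType X Y) n :
    chain R X n -> chain R Y n :=
  fglift (fun s : sing_simplex R X n => << (f \o s : sing_simplex R Y n) >>).

HB.instance Definition _ X Y (f : continuousType X Y) n :=
  GRing.Linear.copy (@chain_map X Y f n) (fglift _).

Lemma chain_map_simplex X Y (f : continuousType X Y) n (s : sing_simplex R X n) :
  chain_map f << s >> = << (f \o s : sing_simplex R Y n) >>.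
Proof. by rewrite /chain_map liftU scale1r. Qed.

Lemma bd_chain_map X Y (f : continuousType X Y) n (c : chain R X n.+1) :
  bd (chain_map f c) = chain_map f (bd c).
Proof.
apply: (@freeg_linear_ext _ _ _
  (@bd R Y n \o @chain_map X Y f n.+1) (@chain_map X Y f n \o @bd R X n)) => s /=.
rewrite chain_map_simplex !bd_simplex linear_sum; apply: eq_bigr => i _.
rewrite linearZ /= chain_map_simplex; congr (_ *: << _ >>).
exact/continuousEP.
Qed.

Lemma chain_map_comp X Y Z (f : continuousType X Y) (g : continuousType Y Z) n
    (c : chain R X n) :
  chain_map g (chain_map f c) = chain_map (g \o f) c.
Proof.
apply: (@freeg_linear_ext _ _ _
  (@chain_map Y Z g n \o @chain_map X Y f n) (@chain_map X Z (g \o f) n)) => s /=.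
by rewrite !chain_map_simplex; congr (<< _ >>); exact/continuousEP.
Qed.

Lemma chain_map_id X n (c : chain R X n) : chain_map idfun c = c.
Proof.
apply: (@freeg_linear_ext _ _ _ (@chain_map X X idfun n) idfun) => s /=.
by rewrite !chain_map_simplex; congr (<< _ >>); exact/continuousEP.
Qed.

End singular_chains.

(** * The prism operator of a homotopy *)

Section prism_operator.
Variables (R : realType) (X Y : topologicalType) (H : X * R -> Y).
Hypothesis H_cont : {within [set: X] `*` `[0, 1], continuous H}.
Variables f g : continuousType X Y.
Hypotheses (Hf : forall x, H (x, 0) = f x) (Hg : forall x, H (x, 1) = g x).

Lemma prism_simplex_continuous n (s : sing_simplex R X n)
    (r : seq ('I_n.+1 * bool)) m :
  continuous (fun t : std_simplex R m => H (s (bary r t), bary_height r (val t))).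
Proof.
apply: (within_continuous_into H_cont) => [t|t].
  by split=> //=; exact: bary_height_itv.
have s_cont : (s \o @bary R n r m) @ t --> s (bary r t).
  exact: (cvg_comp _ _ (@bary_continuous R n r m t) (@cts_fun _ _ s _)).
exact: (cvg_pair s_cont (@bary_height_continuous R n r m t)).
Qed.

(** The affine simplex spanned by [r] in the prism, carried to [Y] by [s] times the identity and
    then [H]. It is the expected one when [r] has [m + 1] entries. *)
Definition prism_simplex n (s : sing_simplex R X n) m
    (r : seq ('I_n.+1 * bool)) : sing_simplex R Y m :=
  mkcts (@prism_simplex_continuous n s r m).

Lemma prism_simplex_face n (s : sing_simplex R X n) m r (i : 'I_m.+2) :
  (i < size r)%N ->
  sing_face (prism_simplex s m.+1 r) i = prism_simplex s m (delete_nth i r).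
Proof.
move=> i_lt; apply/continuousEP => t /=.
by rewrite /mkcts /= bary_face // bary_height_face.
Qed.

Lemma prism_simplex_lift n (s : sing_simplex R X n.+1) m r (i : 'I_n.+2) :
  size r = m.+1 ->
  prism_simplex s m [seq (lift i v.1, v.2) | v <- r] =
  prism_simplex (sing_face s i) m r.
Proof.
move=> size_r; apply/continuousEP => t /=.
by rewrite /mkcts /= bary_map_lift // bary_height_map_lift.
Qed.

Lemma bary_enum n (b : bool) (t : std_simplex R n) :
  bary [seq (x, b) | x <- enum 'I_n.+1] t = t.
Proof.
apply/val_inj/rowP => k; rewrite mxE (bigD1 k) //= big1 => [|j j_neq].
  by rewrite (nth_map ord0) ?size_enum_ord // nth_ord_enum eqxx mulr1 addr0.
rewrite (nth_map ord0) ?size_enum_ord // nth_ord_enum /=.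
by rewrite (negPf j_neq) mulr0.
Qed.

Lemma bary_height_enum n (b : bool) (t : std_simplex R n) :
  bary_height [seq (x, b) | x <- enum 'I_n.+1] (val t) = b%:R.
Proof.
have [_ t_sum1] := set_mem (valP t).
rewrite /bary_height -[RHS]mul1r -t_sum1 mulr_suml; apply: eq_bigr => j _.
by rewrite (nth_map ord0) ?size_enum_ord.
Qed.

Definition prism_op n : chain R X n -> chain R Y n.+1 :=
  fglift (fun s => prism (fun r => << prism_simplex s n.+1 r >>)
                         (enum 'I_n.+1)).

HB.instance Definition _ n := GRing.Linear.copy (@prism_op n) (fglift _).

Lemma prism_op_simplex n (s : sing_simplex R X n) :
  prism_op << s >> =
  prism (fun r => << prism_simplex s n.+1 r >>) (enum 'I_n.+1).
Proof. by rewrite /prism_op liftU scale1r. Qed.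

Lemma bd_prism_op_simplex n (s : sing_simplex R X n) :
  bd (prism_op << s >>) = chain_map g << s >> - chain_map f << s >>
    - alt_faces (prism (fun r => << prism_simplex s n r >>)) (enum 'I_n.+1).
Proof.
rewrite prism_op_simplex prism_linear.
(* On lists of the length that occurs, [bd] is [alt_faces], so the combinatorial prism identity
   applies. *)
rewrite (@eq_prism _ _ _ _ (alt_faces (fun r => << prism_simplex s n r >>))).
  rewrite prism_alt_faces !chain_map_simplex; congr (<< _ >> - << _ >> - _);
    apply/continuousEP => t /=.
  - by rewrite /mkcts bary_enum bary_height_enum Hg.
  - by rewrite /mkcts bary_enum bary_height_enum Hf.
move=> r; rewrite size_enum_ord => size_r.
rewrite /= bd_simplex /alt_faces size_r; apply: eq_bigr => i _.
by rewrite prism_simplex_face // size_r.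
Qed.

(** Degree 0 stands apart since [bd] starts in degree 1; the only face of a point is the empty list,
    whose prism is 0. *)
Lemma bd_prism_op0 (c : chain R X 0) :
  bd (prism_op c) = chain_map g c - chain_map f c.
Proof.
apply: (@freeg_linear_ext _ _ _
  (@bd R Y 0 \o @prism_op 0) (@chain_map R X Y g 0 \- @chain_map R X Y f 0)) => s /=.
rewrite bd_prism_op_simplex enum_ordSl (size0nil (size_enum_ord 0)) /=.
by rewrite alt_faces_cons /= /alt_faces big_ord0 !subr0.
Qed.

(** The chain homotopy identity. The prisms over the faces of the vertex list sum to
    [prism_op (bd c)] by naturality, [prism_simplex_lift]. *)
Lemma bd_prism_opS n (c : chain R X n.+1) :
  bd (prism_op c) = chain_map g c - chain_map f c - prism_op (bd c).
Proof.
apply: (@freeg_linear_ext _ _ _ (@bd R Y n.+1 \o @prism_op n.+1)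
  ((@chain_map R X Y g n.+1 \- @chain_map R X Y f n.+1)
     \- (@prism_op n \o @bd R X n))) => s /=.
rewrite bd_prism_op_simplex; congr (_ - _).
rewrite bd_simplex linear_sum /alt_faces size_enum_ord; apply: eq_bigr => i _.
rewrite linearZ /= prism_op_simplex delete_nth_enum prism_map; congr (_ *: _).
apply: eq_prism => r; rewrite size_enum_ord => size_r.
by rewrite prism_simplex_lift.
Qed.

Lemma homotopic_cycle n (c : chain R X n) : is_cycle c ->
  is_boundary (chain_map g c - chain_map f c).
Proof.
case: n c => [|n] c; first by exists (prism_op c); exact: bd_prism_op0.
move=> /= bd_c; exists (prism_op c).
by rewrite bd_prism_opS bd_c linear0 subr0.
Qed.

End prism_operator.

(** * Homotopy invariance of the Euler characteristic *)

Section homotopy_invariance.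
Variable R : realType.
Implicit Types X Y : topologicalType.

Lemma is_boundaryD X n (c d : chain R X n) :
  is_boundary c -> is_boundary d -> is_boundary (c + d).
Proof. by move=> [a <-] [b <-]; exists (a + b); rewrite linearD. Qed.

Lemma is_boundaryZ X n (k : rat) (c : chain R X n) :
  is_boundary c -> is_boundary (k *: c).
Proof. by move=> [a <-]; exists (k *: a); rewrite linearZ. Qed.

Lemma is_boundaryN X n (c : chain R X n) : is_boundary c -> is_boundary (- c).
Proof. by move=> [a <-]; exists (- a); rewrite linearN. Qed.

Lemma is_boundary_sum X n k (c : 'I_k -> chain R X n) :
  (forall i, is_boundary (c i)) -> is_boundary (\sum_i c i).
Proof.
move=> c_bd; elim/big_rec: _ => [|i d _ d_bd]; last exact: is_boundaryD.
by exists 0; rewrite linear0.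
Qed.

Lemma is_boundary_trans X n (c d : chain R X n) :
  is_boundary (c - d) -> is_boundary d -> is_boundary c.
Proof. by rewrite -{2}[c](subrK d); exact: is_boundaryD. Qed.

Lemma chain_map_cycle X Y (f : continuousType X Y) n (c : chain R X n) :
  is_cycle c -> is_cycle (chain_map f c).
Proof. by case: n c => //= n c; rewrite bd_chain_map => ->; rewrite linear0. Qed.

Lemma chain_map_boundary X Y (f : continuousType X Y) n (c : chain R X n) :
  is_boundary c -> is_boundary (chain_map f c).
Proof. by move=> [b <-]; exists (chain_map f b); rewrite bd_chain_map. Qed.

Lemma homotopic_id_boundary X (h : continuousType X X) n (c : chain R X n) :
  homotopic R h idfun -> is_cycle c -> is_boundary (c - chain_map h c).
Proof.
move=> [H [H_cont H0 H1]] c_cycle; rewrite -{1}[c]chain_map_id.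
exact: (homotopic_cycle H_cont H0 H1).
Qed.

Lemma homotopy_equivalent_sym X Y :
  homotopy_equivalent R X Y -> homotopy_equivalent R Y X.
Proof. by move=> [f [g [? ? ? ?]]]; exists g, f. Qed.

(** The images of the basis [z] under [f] form a basis for [Y]. The coordinates of a cycle [c] are
    those of [chain_map g c], because both round trips change a cycle only by a boundary. *)
Lemma homotopy_equivalent_betti X Y n k :
  homotopy_equivalent R X Y -> has_betti R X n k -> has_betti R Y n k.
Proof.
move=> [f0 [g0 [f_cont g_cont gf_id fg_id]]] [z [z_cycle z_basis]].
pose f : continuousType X Y := mkcts f_cont.
pose g : continuousType Y X := mkcts g_cont.
have gfP (c : chain R X n) : is_cycle c -> is_boundary (c - chain_map g (chain_map f c)).
  by rewrite chain_map_comp; apply: (@homotopic_id_boundary X (g \o f)).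
have fgP (c : chain R Y n) : is_cycle c -> is_boundary (c - chain_map f (chain_map g c)).
  by rewrite chain_map_comp; apply: (@homotopic_id_boundary Y (f \o g)).
exists (fun i => chain_map f (z i)); split=> [i|c c_cycle].
  exact: chain_map_cycle.
have [a [a_bd a_uniq]] := z_basis _ (chain_map_cycle g c_cycle).
exists a; split=> [|b b_bd].
  apply: is_boundary_trans (chain_map_boundary f a_bd).
  have fa : chain_map f (\sum_i a i *: z i) = \sum_i a i *: chain_map f (z i).
    by rewrite linear_sum; apply: eq_bigr => i _; rewrite linearZ.
  by rewrite linearB /= fa opprB subrKA; exact: fgP.
apply: a_uniq; apply: is_boundary_trans (chain_map_boundary g b_bd).
rewrite linearB /= opprB addrC subrKA linear_sum -sumrB.
apply: is_boundary_sum => i; rewrite linearZ /= -scalerBr; apply: is_boundaryZ.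
by rewrite -opprB; apply: is_boundaryN; exact: gfP.
Qed.

Lemma homotopy_equivalent_has_euler X Y x :
  homotopy_equivalent R X Y -> has_euler R X x -> has_euler R Y x.
Proof.
move=> XY [b [N [b_betti b0 xE]]]; exists b, N; split=> // n.
exact: homotopy_equivalent_betti XY (b_betti n).
Qed.

Lemma homotopy_equivalent_euler X Y :
  homotopy_equivalent R X Y -> euler R X = euler R Y.
Proof.
move=> XY; rewrite /euler; congr (xget 0 _).
apply/seteqP; split=> x /=; apply: homotopy_equivalent_has_euler => //.
exact: homotopy_equivalent_sym.
Qed.

(** The standard simplex has a point, so there are no singular simplices and all chains vanish. Then
    any coefficients represent 0, and their uniqueness forces an empty basis. *)
Lemma has_euler_empty X x : (X -> False) -> has_euler R X x -> x = 0.
Proof.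
move=> X0 [b [N [b_betti _ ->]]]; rewrite big1 // => n _.
suff -> : b n = 0%N by rewrite mulr0.
have chain0 m (c : chain R X m) : c = 0.
  rewrite -[c]freeg_sumE big1_seq // => s _; exfalso; apply: X0; apply: s.
  exists (delta_mx ord0 ord0); apply/mem_set; split=> [i|].
    by rewrite mxE ler0n.
  rewrite (bigD1 ord0) //= mxE eqxx big1 ?addr0 // => i /negPf i0.
  by rewrite mxE i0 andbF.
have [z [_ z_basis]] := b_betti n.
have [|a [_ a_uniq]] := z_basis 0.
  by case: (val n) => //= m; rewrite linear0.
have all_a a' : a = a'.
  by apply: a_uniq; exists 0; rewrite [LHS]chain0 [RHS]chain0.
case: (b n) a all_a {a_uniq z z_basis} => // k a all_a.
have /ffunP/(_ ord0) := etrans (esym (all_a [ffun=> 0])) (all_a [ffun=> 1]).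
by rewrite !ffunE.
Qed.

(** Either a witness is 0 by the preceding lemma, or [xget] returns its default, also 0. *)
Lemma euler_empty X : (X -> False) -> euler R X = 0.
Proof. by move=> X0; rewrite /euler; case: xgetP => // x _; apply: has_euler_empty. Qed.

End homotopy_invariance.

(** * Step functions on the line *)

Section locally_constant.
Variables (R : realType) (T : Type).

(** Intervals are connected, and the part of [A] inside the interior of [level] is nonempty and
    relatively open and closed. *)
Lemma locally_constant_itv (phi : R -> T) (A : set R) :
  is_interval A ->
  (forall u, A u -> \forall w \near u, phi w = phi u) ->
  forall u w, A u -> A w -> phi u = phi w.
Proof.
move=> /connected_intervalP A_conn phi_loc u w Au Aw.
pose level := [set x | phi x = phi u].
(* If some point near [x] had the value [phi u], so would [x] and all its neighbours. *)
have level_out x : A x -> ~ level^° x -> (~` level)^° x.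
  move=> Ax x_out; have : \forall y \near x, phi y = phi x by exact: phi_loc.
  apply: filterS => y yx yu; apply: x_out.
  rewrite /interior; near=> z; rewrite /level /=; near: z.
  by rewrite -yu yx; exact: phi_loc.
have AE : A `&` level^° = A.
  apply: A_conn.
  - by exists u; split=> //; exact: phi_loc.
  - by exists (level^°) => //; exact: open_interior.
  - exists (~` (~` level)^°); first exact/open_closedC/open_interior.
    apply/seteqP; split=> x [Ax x_in]; split=> //.
      by move=> /interior_subset; apply; exact: interior_subset.
    by apply: contrapT => /(level_out _ Ax).
have : (A `&` level^°) w by rewrite AE.
by move=> [_ /interior_subset].
Unshelve. all: by end_near. Qed.

End locally_constant.

(** [C] without [u] is finite, hence closed, so a ball around [u] misses it. *)
Lemma finite_isolated (R : realType) (C : set R) (u : R) : finite_set C ->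
  exists2 e, 0 < e & forall v, C v -> `|v - u| < e -> v = u.
Proof.
move=> C_fin; have : closed (C `\ u).
  apply: (@accessible_finite_set_closed R).1; last exact: finite_setD.
  exact/hausdorff_accessible/Rhausdorff.
move=> /closed_openC; rewrite openE => /(_ u) /=.
rewrite /interior => -[|e /= e_gt0 eP]; first by case.
exists e => // v Cv vu; apply: contrapT => v_neq.
by apply: (eP v); [rewrite /= distrC|].
Qed.

Section step_function.
Variables (R : realType) (V : zmodType) (phi : R -> V) (s : seq R).
Hypothesis s_uniq : uniq s.
Hypothesis phi_loc : forall u, u \notin s -> \forall w \near u, phi w = phi u.

(** [q] packs the left value, the right value and a radius, so that one use of [choice] yields all
    three as functions of [u]. Each side of [u] within the radius is an interval free of [s]. *)
Lemma one_sided_values (u : R) : exists q : V * V * R,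
  [/\ 0 < q.2, forall v, v \in s -> `|v - u| < q.2 -> v = u,
      forall w, u - q.2 < w < u -> phi w = q.1.1 &
      forall w, u < w < u + q.2 -> phi w = q.1.2].
Proof.
have [e e_gt0 eP] := finite_isolated u (finite_seq s).
have e2_gt0 : 0 < e / 2 by rewrite divr_gt0.
exists (phi (u - e / 2), phi (u + e / 2), e); split=> //= w w_itv.
  apply: (@locally_constant_itv R V phi `]u - e, u[%classic).
  - exact: interval_is_interval.
  - move=> x /=; rewrite in_itv /= => /andP[x_gt x_lt]; apply: phi_loc; apply/negP => Cx.
    have xu : x = u by apply: eP => //; rewrite ltr_norml; lra.
    by rewrite xu ltxx in x_lt.
  - by rewrite /= in_itv.
  - by rewrite /= in_itv /=; lra.
apply: (@locally_constant_itv R V phi `]u, u + e[%classic).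
- exact: interval_is_interval.
- move=> x /=; rewrite in_itv /= => /andP[x_gt x_lt]; apply: phi_loc; apply/negP => Cx.
  have xu : x = u by apply: eP => //; rewrite ltr_norml; lra.
  by rewrite xu ltxx in x_gt.
- by rewrite /= in_itv.
- by rewrite /= in_itv /=; lra.
Qed.

Variables (lo hi : R) (total : V).
Hypotheses (phi_lo : forall u, u < lo -> phi u = 0)
           (phi_hi : forall u, hi < u -> phi u = total).

(* Correcting [phi] at the points of [s] to its left limit and subtracting the
   jumps to the left of [u] leaves a locally constant, hence constant, function
   of [u]. *)
Lemma step_function_jumps : exists D : R -> V,
  [/\ forall v, \forall e \near 0^'+, phi (v + e) - phi (v - e) = D v,
      forall u, u \notin s -> phi u = \sum_(v <- s | v < u) D v &
      total = \sum_(v <- s) D v].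
Proof.
have [q qP] := choice one_sided_values.
pose L u := (q u).1.1; pose D u := (q u).1.2 - L u.
pose S u := \sum_(v <- s | v < u) D v.
have L_left a b w : a < w <= b -> (forall y, a < y < b -> phi y = phi ((a + w) / 2)) ->
    L w = phi ((a + w) / 2).
  move=> aw_b phi_ab; have [ew_gt0 _ Lw _] := qP w.
  (* A point of []a, w[] within the radius of [w]: there [phi] is both the left value and the
     constant. *)
  pose y := Num.max (w - (q w).2 / 2) ((a + w) / 2).
  have [y_ge1 y_ge2] : w - (q w).2 / 2 <= y /\ (a + w) / 2 <= y.
    by rewrite !le_max !lexx orbT.
  have y_lt : y < w by rewrite gt_max; apply/andP; split; lra.
  by rewrite -(phi_ab y) ?(Lw y) //; lra.
have L_phi u : u \notin s -> L u = phi u.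
  move=> /phi_loc[e /= e_gt0 eP]; rewrite (L_left (u - e) u).
  - by apply: eP; rewrite /= gtr0_norm; lra.
  - lra.
  - move=> y y_itv; rewrite !eP //= gtr0_norm; lra.
have R_phi u : u \notin s -> (q u).1.2 = phi u.
  move=> /phi_loc[e /= e_gt0 eP]; have [d_gt0 _ _ Rd] := qP u.
  pose d := Num.min ((q u).2 / 2) (e / 2).
  have d2_gt0 : 0 < d by rewrite lt_min; apply/andP; split; lra.
  have [d_le1 d_le2] : d <= (q u).2 / 2 /\ d <= e / 2.
    by rewrite !ge_min !lexx orbT.
  rewrite -(Rd (u + d)); last lra.
  by apply: eP; rewrite /= ltr0_norm; lra.
have LS_loc u : \forall w \near u, L w - S w = L u - S u.
  have [e_gt0 eP Lu Ru] := qP u; exists (q u).2 => //= w.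
  rewrite /= ltr_norml => w_near.
  have [w_lt|w_gt|->//] := ltgtP w u.
    congr (_ - _).
      rewrite (L_left (u - (q u).2) u); [by apply: Lu; lra|lra|].
      by move=> y y_itv; rewrite !Lu //; lra.
    rewrite /S big_seq_cond [RHS]big_seq_cond; apply: eq_bigl => v.
    have [v_s /=|//] := boolP (v \in s).
    apply/idP/idP => v_lt; first lra.
    rewrite ltNge; apply/negP => w_le.
    have vu : v = u by apply: eP => //; rewrite ltr_norml; lra.
    by rewrite vu ltxx in v_lt.
  (* Right of [u], [L] becomes the right value at [u], and [S] gains exactly the term [D u] if [u]
     is in [s]. If it is not, the two one-sided values agree. *)
  have -> : L w = (q u).1.2.
    rewrite (L_left u (u + (q u).2)); [by apply: Ru; lra|lra|].
    by move=> y y_itv; rewrite !Ru //; lra.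
  have S_off : \sum_(v <- s | (v != u) && (v < w)) D v =
               \sum_(v <- s | (v != u) && (v < u)) D v.
    rewrite big_seq_cond [RHS]big_seq_cond; apply: eq_bigl => v.
    have [v_s /=|//] := boolP (v \in s).
    case: eqP => //= v_neq; apply/idP/idP => v_lt; last lra.
    rewrite ltNge; apply/negP => u_le.
    by apply: v_neq; apply: eP => //; rewrite ltr_norml; lra.
  have SE x : S x = (if (u \in s) && (u < x) then D u else 0) +
      \sum_(v <- s | (v != u) && (v < x)) D v.
    rewrite /S (bigID (pred1 u)) /=; congr (_ + _); last first.
      by apply: eq_bigl => v; rewrite andbC.
    case: ifP => [/andP[u_s u_lt]|u_out].
      by rewrite big_mkcond (bigD1_seq u) ?s_uniq //= u_lt eqxx big1 ?addr0 //
        => v /negPf->; rewrite andbF.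
    rewrite big1_seq // => v /andP[/andP[v_lt /eqP vu] v_s].
    by move: u_out; rewrite -vu v_s v_lt.
  rewrite !SE w_gt ltxx andbT andbF add0r S_off opprD addrA; congr (_ - _).
  case: ifP => [_|/negP u_out]; first by rewrite /D subKr.
  by rewrite subr0 R_phi ?L_phi //; exact/negP.
have LS_cst u w : L u - S u = L w - S w.
  by apply: (@locally_constant_itv R V (fun u => L u - S u) setT).
have [a a_lo a_s] : exists2 a, a < lo & forall v, v \in s -> a < v.
  elim: (s) => [|v r [a a_lo a_r]]; first by exists (lo - 1) => //; lra.
  exists (Num.min a (v - 1)) => [|w]; first by rewrite gt_min a_lo.
  by rewrite inE gt_min => /predU1P[->|/a_r->//]; apply/orP; right; lra.
have [b b_hi b_s] : exists2 b, hi < b & forall v, v \in s -> v < b.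
  elim: (s) => [|v r [b b_hi b_r]]; first by exists (hi + 1) => //; lra.
  exists (Num.max b (v + 1)) => [|w]; first by rewrite lt_max b_hi.
  by rewrite inE lt_max => /predU1P[->|/b_r->//]; apply/orP; right; lra.
(* At [a], left of [lo] and of all of [s], both [L] and [S] vanish, so their constant difference is
   0. *)
have LE u : L u = S u.
  apply/eqP; rewrite -subr_eq0 (LS_cst u a) (L_left (a - 1) a); first last.
  - by move=> y y_itv; rewrite !phi_lo //; lra.
  - lra.
  rewrite phi_lo; last lra.
  rewrite sub0r oppr_eq0 /S big1_seq // => v /andP[v_a /a_s a_v].
  by have := lt_trans v_a a_v; rewrite ltxx.
exists D; split=> [v|u u_s|].
- have [e_gt0 _ Lv Rv] := qP v; near=> e.
  have e_gt : 0 < e by near: e; exact: nbhs_right_gt.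
  have e_lt : e < (q v).2 by near: e; exact: nbhs_right_lt.
  by rewrite Rv ?Lv //; lra.
- by rewrite -(L_phi u u_s) LE.
(* At [b], beyond [hi] and all of [s], every jump has been counted. *)
have bE : L b = total.
  rewrite (L_left hi b); first by rewrite phi_hi //; lra.
  - lra.
  - by move=> y y_itv; rewrite !phi_hi //; lra.
rewrite -bE LE /S big_seq_cond [RHS]big_seq; apply: eq_bigl => v.
by case: (boolP (v \in s)) => //= /b_s ->.
Unshelve. all: by end_near. Qed.

End step_function.

(** * Integrals over the half-line *)

Section half_line_integral.
Variable R : realType.
Implicit Types F G : R -> R.
Local Notation mu := (@lebesgue_measure R).
Local Notation half_line := `[(0 : R), +oo[%classic.

(** Integrability is bundled with the value so that both pass together through sums and
    multiples. *)
Definition half_line_integral F (I : R) : Prop :=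
  mu.-integrable half_line (EFin \o F) /\
  (\int[mu]_(u in half_line) (F u)%:E = I%:E)%E.

Lemma half_line_integralD F G I J :
  half_line_integral F I -> half_line_integral G J ->
  half_line_integral (F \+ G) (I + J).
Proof.
move=> [F_int FE] [G_int GE]; split.
  exact: (integrableD _ F_int G_int).
by rewrite (integralD _ F_int G_int) //= FE GE.
Qed.

Lemma half_line_integralZ k F I :
  half_line_integral F I -> half_line_integral (k \*o F) (k * I).
Proof.
move=> [F_int FE]; split; first exact: (integrableZl _ k F_int).
by rewrite (integralZl _ F_int) //= FE.
Qed.

Lemma half_line_integral_sum (T : Type) (r : seq T) (F : T -> R -> R)
    (I : T -> R) :
  (forall i, half_line_integral (F i) (I i)) ->
  half_line_integral (fun u => \sum_(i <- r) F i u) (\sum_(i <- r) I i).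
Proof.
move=> FI; elim: r => [|i r IHr].
  rewrite big_nil; under eq_fun do rewrite big_nil.
  by split; [exact: integrable0|exact: integral0].
rewrite big_cons; under eq_fun do rewrite big_cons.
exact: half_line_integralD.
Qed.

Lemma half_line_integral_indic (a b : R) (b0 b1 : bool) : 0 <= a -> a <= b ->
  half_line_integral \1_[set` Interval (BSide b0 a) (BSide b1 b)] (b - a).
Proof.
move=> a_ge0 ab; split.
  by apply: (integrableS _ _ (subsetT _) (integrable_indic_itv _ _ _ _)).
rewrite integral_indic // setIidl; last first.
  move=> x /=; rewrite !itv_boundlr /= => /andP[ax _].
  by rewrite andbT; apply: le_trans ax; rewrite leBSide; case: (b0).
rewrite [LHS]lebesgue_measure_itv /= lte_fin.
by case: ltgtP ab => // -> _; rewrite subrr.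
Qed.

Lemma half_line_integral_eq F G I : (forall u, 0 <= u -> F u = G u) ->
  half_line_integral G I -> (\int[mu]_(u in half_line) (F u)%:E = I%:E)%E.
Proof.
move=> FG [_ <-]; apply: eq_integral => u; rewrite inE /= in_itv /= andbT.
by move=> /FG->.
Qed.

(* The integrand agrees with the sum of the [D v * kernel v] outside the finite
   set of the absolute values of [s]; it is corrected there by multiples of
   indicators of points, which spares a separate measurability argument. *)
Lemma integral_step_function (phi : R -> int) (s : seq R) (D : R -> int)
    (total : int) :
  (forall u, u \notin s -> phi u = \sum_(v <- s | v < u) D v) ->
  total = \sum_(v <- s) D v ->
  (\int[mu]_(u in half_line) ((total - phi u - phi (- u))%:~R%R)%:E =
   (\sum_(v <- s) (D v)%:~R * v)%:E)%E.
Proof.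
move=> phiE totalE.
(* For [u >= 0] this is 1[u <= v] - 1[v < -u]; the endpoint types follow the weak and the strict
   inequality. *)
pose kernel v : R -> R :=
  if 0 <= v then \1_[set` `[0, v]] else (- 1) \*o \1_[set` `[0, - v[].
have kernel_int v : half_line_integral (kernel v) v.
  rewrite /kernel; case: lerP => v0.
    by rewrite -{2}[v]subr0; exact: half_line_integral_indic.
  have := half_line_integralZ (-1) (half_line_integral_indic true true (lexx 0) _).
  by move=> /(_ (- v)); rewrite subr0 mulN1r opprK; apply; rewrite oppr_ge0 ltW.
have kernelE (v u : R) : 0 <= u ->
    kernel v u = (u <= v)%R%:R - (v < - u)%R%:R.
  move=> u0; rewrite /kernel; case: (lerP 0 v) => v0 /=;
    rewrite indicE mem_setE in_itv /= u0 /=.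
    by rewrite (ltNge v) (le_trans (_ : - u <= 0) v0) ?oppr_le0 // subr0.
  by rewrite leNgt (lt_le_trans v0 u0) /= sub0r mulN1r ltrNr.
pose F u : R := (total - phi u - phi (- u))%:~R.
pose G u := \sum_(v <- s) (D v)%:~R * kernel v u.
pose N := undup [seq `|v| | v <- s].
(* Writing [|p|] keeps the endpoint nonnegative for every real [p], as [half_line_integral_sum]
   quantifies over all indices. *)
have point_indic p u : p \in N -> \1_[set` `[`|p|, `|p| ] ] u = (p == u)%:R :> R.
  rewrite mem_undup => /mapP[v _ ->].
  by rewrite indicE mem_setE in_itv /= normr_id -eq_le.
apply: (@half_line_integral_eq F (G \+
  (fun u => \sum_(p <- N) (F p - G p) * \1_[set` `[`|p|, `|p| ] ] u))).
  move=> u u0 /=; case: (boolP (u \in N)) => uN.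
    rewrite (bigD1_seq u) ?undup_uniq //= big1_seq => [|p /andP[p_u pN]].
      by rewrite addr0 point_indic // eqxx mulr1 addrC subrK.
    by rewrite point_indic // (negPf p_u) mulr0.
  rewrite big1_seq ?addr0 => [|p /andP[_ pN]].
    have [us mus] : u \notin s /\ - u \notin s.
      split; apply/negP => us; move: uN; rewrite mem_undup => /mapP; apply.
        by exists u => //; rewrite ger0_norm.
      by exists (- u) => //; rewrite normrN ger0_norm.
    (* Both values of [phi] and [total] are now sums of jumps over [s], compared termwise through 1
       - 1[v < u] = 1[u <= v]. *)
    rewrite /F /G phiE // phiE // totalE (big_mkcond (fun v => v < u)).
    rewrite (big_mkcond (fun v => v < - u)) -!sumrB rmorph_sum /=.
    apply: eq_bigr => v _; rewrite kernelE // leNgt.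
    by case: (v < u); case: (v < - u); rewrite /= !rmorphB /= ; ring.
  by rewrite point_indic //; case: eqP pN uN => [-> ->|]; rewrite ?mulr0.
rewrite -[X in half_line_integral _ X]addr0; apply: half_line_integralD.
  by apply: half_line_integral_sum => v; exact: half_line_integralZ.
have correction0 : \sum_(p <- N) (F p - G p) * (`|p| - `|p|) = 0.
  by rewrite big1 // => p _; rewrite subrr mulr0.
rewrite -[X in half_line_integral _ X]correction0.
apply: half_line_integral_sum => p; apply: half_line_integralZ.
exact: half_line_integral_indic.
Qed.

End half_line_integral.

(** * Tame functions *)

Lemma homotopic_refl (R : realType) (X Y : topologicalType) (f g : X -> Y) :
  continuous f -> f =1 g -> homotopic R f g.
Proof.
move=> f_cont fg; exists (f \o fst); split=> //=.
apply: continuous_subspaceT => x.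
by apply: continuous_comp; [exact: cvg_fst|exact: f_cont].
Qed.

(** A full subset, used as a type, is still distinct from [X]; [val] is a homeomorphism between
    them. *)
Lemma homotopy_equivalent_setT (R : realType) (X : topologicalType) (A : set X) :
  (forall x, A x) -> homotopy_equivalent R A X.
Proof.
move=> A_all; pose g (x : X) : A := SigSub (mem_set (A_all x)).
have val_cont : continuous (val : A -> X) by exact: initial_continuous.
have g_cont : continuous g by apply: continuous_comp_initial => x.
exists val, g; split=> //; apply: homotopic_refl.
- by move=> a; exact: (continuous_comp (val_cont a) (g_cont _)).
- by move=> a; exact: val_inj.
- by move=> x; exact: (continuous_comp (g_cont x) (val_cont _)).
- by [].
Qed.

Section tame_functions.
Variables (R : realType) (X : topologicalType) (f : X -> R).

Lemma chi_le_locally_constant (u : R) : ~ CV f u ->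
  \forall w \near u, chi_le f w = chi_le f u.
Proof.
move=> /contrapT; apply: filterS => w wu.
exact: homotopy_equivalent_euler wu.
Qed.

Lemma chi_le_lower (M u : R) : (forall x, `|f x| <= M) -> u < - M ->
  chi_le f u = 0.
Proof.
move=> fM uM; apply: euler_empty => -[x /set_mem /=]; rewrite in_itv /= => fxu.
by have := fM x; rewrite ler_norml; lra.
Qed.

Lemma chi_le_upper (M u : R) : (forall x, `|f x| <= M) -> M < u ->
  chi_le f u = euler R X.
Proof.
move=> fM Mu; apply: homotopy_equivalent_euler; apply: homotopy_equivalent_setT.
by move=> x; rewrite /= in_itv /= (le_trans (ler_norm _)) // (le_trans (fM x)) // ltW.
Qed.

(** Two eventual values agree at a common small [e], so [xget] can only return [d]. *)
Lemma Delta_chiE (v : R) (d : int) :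
  (\forall e \near 0^'+, chi_le f (v + e) - chi_le f (v - e) = d) ->
  Delta_chi f v = d.
Proof.
move=> d_near; rewrite /Delta_chi; case: xgetP => [d' _ /= d'_near|/(_ d)//].
near (0 : R)^'+ => e; transitivity (chi_le f (v + e) - chi_le f (v - e)).
  by apply: esym; near: e.
by near: e.
Unshelve. all: by end_near. Qed.

End tame_functions.

Theorem proposition2p4 (R : realType) (X : topologicalType) (f : X -> R)
    (f_tame : tame f) :
  upper_euler_integral f = (\sum_(v \in CV f) (Delta_chi f v)%:~R * v)%:E.
Proof.
have [X_cpt _ f_cont [/finite_seqP[s0 CVs0] _] _] := f_tame.
pose s := undup s0.
have s_uniq : uniq s by exact: undup_uniq.
have CVs : CV f = [set` s].
  by rewrite CVs0; apply/seteqP; split=> v /=; rewrite mem_undup.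
have [M fM] : exists M, forall x, `|f x| <= M.
  have /compact_bounded : compact (f @` setT).
    by by apply: continuous_compact => //; exact: continuous_subspaceT.
  (* Boundedness gives the estimate for every number strictly above [M]. *)
  move=> [M [_ MP]]; exists (M + 1) => x.
  have M_lt : M < M + 1 by rewrite ltrDl.
  by apply: (MP _ M_lt (f x)); exists x.
(* Here [lo] is [- M], [hi] is [M] and [total] is the Euler characteristic of [X]; the first
   function transports [CV f] to [s] along [CVs]. *)
have [D [D_near chiE totalE]] := step_function_jumps s_uniq
  (fun u us => chi_le_locally_constant (u := u) (f := f)
     (fun uCV : CV f u => negP us (eq_ind _ (fun A : set R => A u) uCV _ CVs)))
  (fun u => chi_le_lower fM) (fun u => chi_le_upper fM).
rewrite /upper_euler_integral /chi_gt (integral_step_function chiE totalE).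
congr (_%:E); rewrite CVs -fsbig_seq //; apply: eq_bigr => v _.
by rewrite (Delta_chiE (D_near v)).
Qed.
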